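(* Let $n\ge1$, let $\mathfrak p=\oplus_{j}\mathfrak p_j$ be a parabolic subalgebra of $W_\infty^{(n)}$, and for $k\ge1$ let $I_{-k}\subseteq[w]_n\mathbb C[w]$ be the subspace with $\mathfrak p_{-k}=\{t^{-k}f(D):f\in I_{-k}\}$. (a) If $n\le2$, then $I_{-k}$ is an ideal of $\mathbb C[w]$ for all $k\ge1$ (whereas for every $n>2$ there are examples of parabolic subalgebras of $W_\infty^{(n)}$ for which $I_{-1}$ is not an ideal). (b) If $I_{-k}\ne0$, then $I_{-k}$ has finite codimension in $\mathbb C[w]$.
   Context: $[x]_l=x(x-1)\cdots(x-l+1)$. Let $\mathcal D$ be the Lie algebra of differential operators on $\mathbb C[t,t^{-1}]$ with Laurent polynomial coefficients, spanned by $t^kf(D)$, $k\in\mathbb Z$, $f\in\mathbb C[w]$, $D=t\partial_t$. Let $\Psi$ be the skew-symmetric 2-cocycle with $\Psi(t^rf(D),t^sg(D))=\sum_{-r\le m\le-1}f(m)g(m+r)$ if $r=-s\ge0$ and $0$ if $r+s\ne0$. $W_\infty^{(n)}=\mathcal D\partial_t^n\oplus\mathbb C C$ with bracket $[t^rf(D),t^sg(D)]=t^{r+s}(f(D+s)g(D)-f(D)g(D+r))+\Psi(t^rf(D),t^sg(D))C$, $C$ central; it is $\mathbb Z$-graded with $(W_\infty^{(n)})_j=\{t^jf(D)[D]_n:f\in\mathbb C[w]\}+\delta_{j0}\mathbb C C$. A parabolic subalgebra of a $\mathbb Z$-graded Lie algebra $\mathfrak g$ is a graded subalgebra $\mathfrak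 p=\oplus_j\mathfrak p_j$ with $\mathfrak p_j=\mathfrak g_j$ for $j\ge0$ and $\mathfrak p_j\ne0$ for some $j<0$. *)

(* Defs.v *)
From HB Require Import structures.
From mathcomp Require Import all_boot all_order all_algebra finmap.
From mathcomp Require Import monalg complex.
From mathcomp Require Import boolp classical_sets reals.

Set Implicit Arguments.
Unset Strict Implicit.
Unset Printing Implicit Defensive.

Import GRing.Theory.
Local Open Scope ring_scope.
Local Open Scope classical_set_scope.

Definition is_subspace (K : nzRingType) (V : lmodType K) (S : set V) : Prop :=
  S 0 /\ forall (a : K) (u v : V), S u -> S v -> S (a *: u + v).

(* The unit ideal is allowed. *)
Definition is_ideal (A : comNzRingType) (I : set A) : Prop :=
  [/\ I 0,
      forall f g, I f -> I g -> I (f + g)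
    & forall a f, I f -> I (a * f)].

(* The quotient V / S is spanned by the classes of finitely many vectors. *)
Definition finite_codim (K : nzRingType) (V : lmodType K) (S : set V) : Prop :=
  exists s : seq V, forall v : V, exists (u : V) (c : nat -> K),
    S u /\ v = u + \sum_(i < size s) c i *: s`_i.

(* [br] is a bilinear bracket on the ambient space [V]; the Lie algebra is the
   subspace [g] of [V], with homogeneous components [gr j], [j : int]. *)

Section Parabolic.
Variables (K : nzRingType) (V : lmodType K) (br : V -> V -> V).
Variables (g : set V) (gr : int -> set V).

Definition is_subalgebra (p : set V) : Prop :=
  [/\ is_subspace p, p `<=` g & forall u v, p u -> p v -> p (br u v)].

Definition hcomp (p : set V) (j : int) : set V := p `&` gr j.

Definition is_graded (p : set V) : Prop :=
  forall u, p u -> exists s : seq V,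
    (forall v, v \in s -> exists j, hcomp p j v) /\ u = \sum_(v <- s) v.

Definition is_parabolic (p : set V) : Prop :=
  [/\ is_subalgebra p, is_graded p,
      forall j : int, 0 <= j -> hcomp p j = gr j
    & exists2 j : int, j < 0 & hcomp p j <> [set 0]].

End Parabolic.

Section BilinearExtension.
Variables (G H Z : zmodType) (F : int -> int -> G -> H -> Z).
Hypothesis FDl : forall r s g, {morph F r s ^~ g : f f' / f + f'}.
Hypothesis FDr : forall r s f, {morph F r s f : g g' / g + g'}.
Implicit Types (x : {malg G[int]}) (y : {malg H[int]}).

Let B x y : Z := \sum_(r <- msupp x) \sum_(s <- msupp y) F r s x@_r y@_s.

Let F0l r s g : F r s 0 g = 0.
Proof. by apply: (addrI (F r s 0 g)); rewrite -FDl !addr0. Qed.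

Let F0r r s f : F r s f 0 = 0.
Proof. by apply: (addrI (F r s f 0)); rewrite -FDr !addr0. Qed.

Lemma bilin_sumE (d e : {fset int}) x y :
    (msupp x `<=` d)%fset -> (msupp y `<=` e)%fset ->
  B x y = \sum_(r <- d) \sum_(s <- e) F r s x@_r y@_s.
Proof.
move=> led lee; rewrite /B (big_fset_incl _ led) => [|r _ rx]; last first.
  by rewrite big1 // => s _; rewrite (mcoeff_outdom rx) F0l.
apply: eq_bigr => r _; rewrite (big_fset_incl _ lee) // => s _ sy.
by rewrite (mcoeff_outdom sy) F0r.
Qed.

Lemma bilin_sumU r s f g : B << f *g r >> << g *g s >> = F r s f g.
Proof.
rewrite (bilin_sumE msuppU_le msuppU_le).
by rewrite !big_seq_fset1 !mcoeffUU.
Qed.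

Lemma bilin_sumDl x x' y : B (x + x') y = B x y + B x' y.
Proof.
have lex : (msupp x `<=` msupp x `|` msupp x')%fset by exact: fsubsetUl.
have lex' : (msupp x' `<=` msupp x `|` msupp x')%fset by exact: fsubsetUr.
have ley := fsubset_refl (msupp y).
rewrite (bilin_sumE (msuppD_le _ _) ley) (bilin_sumE lex ley).
rewrite (bilin_sumE lex' ley) -big_split /=; apply: eq_bigr => r _.
by rewrite -big_split /=; apply: eq_bigr => s _; rewrite mcoeffD FDl.
Qed.

Lemma bilin_sumDr x y y' : B x (y + y') = B x y + B x y'.
Proof.
have ley : (msupp y `<=` msupp y `|` msupp y')%fset by exact: fsubsetUl.
have ley' : (msupp y' `<=` msupp y `|` msupp y')%fset by exact: fsubsetUr.
have lex := fsubset_refl (msupp x).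
rewrite (bilin_sumE lex (msuppD_le _ _)) (bilin_sumE lex ley).
rewrite (bilin_sumE lex ley') -big_split /=; apply: eq_bigr => r _.
by rewrite -big_split /=; apply: eq_bigr => s _; rewrite mcoeffD FDr.
Qed.

Lemma bilin_sum0l y : B 0 y = 0.
Proof. by rewrite /B msupp0 big_seq_fset0. Qed.

Lemma bilin_sum0r x : B x 0 = 0.
Proof. by rewrite /B big1 // => r _; rewrite msupp0 big_seq_fset0. Qed.

End BilinearExtension.

(* A differential operator on C[t, 1/t] is uniquely a finite sum of terms
   t^k f(D), D = t d/dt; it is represented by its coefficients k |-> f.  See [dop_act_mul], [dop_act_inj]
   for the identification with operators on Laurent polynomials. *)

Definition dop (C : fieldType) : Type := {malg {poly C}[int]}.
HB.instance Definition _ (C : fieldType) := GRing.Zmodule.on (dop C).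

Section DifferentialOperators.
Variable C : fieldType.
Implicit Types (f g : {poly C}) (r s k : int) (x y z : dop C).

(* t^k f(D) *)
Definition tD k f : dop C := << f *g k >>.

Definition dop_scale (a : C) x : dop C := a%:P *: (x : {malg {poly C}[int]}).

Lemma dop_scaleA a b x : dop_scale a (dop_scale b x) = dop_scale (a * b) x.
Proof. by rewrite /dop_scale scalerA -polyCM. Qed.

Lemma dop_scale1 : left_id 1 dop_scale.
Proof. by move=> x; rewrite /dop_scale scale1r. Qed.

Lemma dop_scaleDr : right_distributive dop_scale +%R.
Proof. by move=> a x y; exact: scalerDr. Qed.

Lemma dop_scaleDl x : {morph dop_scale^~ x : a b / a + b}.
Proof. by move=> a b; rewrite /dop_scale polyCD scalerDl. Qed.

HB.instance Definition _ := GRing.Zmodule_isLmodule.Build C (dop C)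
  dop_scaleA dop_scale1 dop_scaleDr dop_scaleDl.

(* f(w + s) *)
Definition pshift s f : {poly C} := f \Po ('X + (s%:~R)%:P).

(* Composition of operators: t^r f(D) t^s g(D) = t^(r+s) f(D+s) g(D). *)
Definition dop_mul x y : dop C :=
  \sum_(r <- msupp x) \sum_(s <- msupp y) tD (r + s) (pshift s x@_r * y@_s).

(* [w]_n = w (w - 1) ... (w - n + 1) *)
Definition ffactp (n : nat) : {poly C} := \prod_(i < n) ('X - (i%:R)%:P).

(* d/dt = t^-1 D; [dtn n] = t^-n [D]_n by [dtnE]. *)
Definition dt : dop C := tD (- 1) 'X.
Definition dtn (n : nat) : dop C := iter n (dop_mul dt) (tD 0 1).

(* Sum of f(m) g(m + k) over -k <= m <= -1, with m = i - k. *)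
Definition Psi_sum (k : nat) f g : C :=
  \sum_(i < k) f.[(i%:Z - k%:Z)%:~R] * g.[i%:R].

(* Psi (t^r f(D), t^-r g(D)); the case r < 0 is forced by skew-symmetry. *)
Definition Psi_hom r f g : C :=
  match r with
  | Posz k => Psi_sum k f g
  | Negz k => - Psi_sum k.+1 g f
  end.

Definition Psi x y : C :=
  \sum_(r <- msupp x) \sum_(s <- msupp y)
    (if r + s == 0 then Psi_hom r x@_r y@_s else 0).

(* The pair (x, c) stands for x + c C, with C the central generator. *)

Definition What : lmodType C := (dop C * C^o)%type.

Definition brW (u v : What) : What :=
  (dop_mul u.1 v.1 - dop_mul v.1 u.1, Psi u.1 v.1).

Definition Winf (n : nat) : set What :=
  [set u | exists x, u.1 = dop_mul x (dtn n)].

Definition Winf_gr (n : nat) (j : int) : set What :=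
  [set u | (exists f, u.1 = tD j (f * ffactp n)) /\ (j != 0 -> u.2 = 0)].

Definition W_parabolic (n : nat) (p : set What) : Prop :=
  is_parabolic brW (Winf n) (Winf_gr n) p.

(* I_{-k}, determined by p_{-k} = { t^-k f(D) : f in I_{-k} }; see [IcoefP]. *)
Definition Icoef (n : nat) (p : set What) (k : nat) : set {poly C} :=
  [set f | hcomp (Winf_gr n) p (- k%:Z) (tD (- k%:Z) f, 0)].

Lemma tD_additive k : additive (tD k).
Proof. by move=> f g; rewrite /tD monalgUB. Qed.
HB.instance Definition _ k :=
  GRing.isAdditive.Build {poly C} (dop C) (tD k) (tD_additive k).

Lemma dopE x : x = \sum_(r <- msupp x) tD r x@_r.
Proof. exact: monalgE. Qed.

Lemma pshiftD s : {morph pshift s : f g / f + g}.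
Proof. by move=> f g; exact: comp_polyD. Qed.

Lemma pshiftM s : {morph pshift s : f g / f * g}.
Proof. by move=> f g; exact: comp_polyM. Qed.

Lemma horner_pshift s f (a : C) : (pshift s f).[a] = f.[a + s%:~R].
Proof. by rewrite /pshift horner_comp hornerD hornerX hornerC. Qed.

Let mulF r s f g := tD (r + s) (pshift s f * g).

Let mulFDl r s g : {morph mulF r s ^~ g : f f' / f + f'}.
Proof. by move=> f f'; rewrite /mulF pshiftD mulrDl raddfD. Qed.

Let mulFDr r s f : {morph mulF r s f : g g' / g + g'}.
Proof. by move=> g g'; rewrite /mulF mulrDr raddfD. Qed.

Lemma dop_mul_tD r s f g :
  dop_mul (tD r f) (tD s g) = tD (r + s) (pshift s f * g).
Proof. exact: (bilin_sumU mulFDl mulFDr). Qed.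

Lemma dop_mulDl : left_distributive dop_mul +%R.
Proof. by move=> x x' y; exact: (bilin_sumDl mulFDl mulFDr). Qed.

Lemma dop_mulDr : right_distributive dop_mul +%R.
Proof. by move=> x y y'; exact: (bilin_sumDr mulFDl mulFDr). Qed.

Lemma dop_mul0l : left_zero 0 dop_mul.
Proof. by move=> y; exact: (bilin_sum0l mulF). Qed.

Lemma dop_mul0r : right_zero 0 dop_mul.
Proof. by move=> x; exact: (bilin_sum0r mulF). Qed.

Lemma Psi_sumDl (k : nat) g : {morph Psi_sum k ^~ g : f f' / f + f'}.
Proof.
move=> f f'; rewrite /Psi_sum -big_split; apply: eq_bigr => i _.
by rewrite hornerD mulrDl.
Qed.

Lemma Psi_sumDr (k : nat) f : {morph Psi_sum k f : g g' / g + g'}.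
Proof.
move=> g g'; rewrite /Psi_sum -big_split; apply: eq_bigr => i _.
by rewrite hornerD mulrDr.
Qed.

Let psiF r s f g := if r + s == 0 then Psi_hom r f g else 0.

Let psiFDl r s g : {morph psiF r s ^~ g : f f' / f + f'}.
Proof.
move=> f f'; rewrite /psiF; case: ifP => _; rewrite ?addr0 //.
by case: r => k /=; rewrite ?Psi_sumDl // Psi_sumDr opprD.
Qed.

Let psiFDr r s f : {morph psiF r s f : g g' / g + g'}.
Proof.
move=> g g'; rewrite /psiF; case: ifP => _; rewrite ?addr0 //.
by case: r => k /=; rewrite ?Psi_sumDr // Psi_sumDl opprD.
Qed.

Lemma Psi_tD r s f g :
  Psi (tD r f) (tD s g) = if r + s == 0 then Psi_hom r f g else 0.
Proof. exact: (bilin_sumU psiFDl psiFDr). Qed.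

Lemma Psi_homC r f g : Psi_hom r f g = - Psi_hom (- r) g f.
Proof.
case: r => [[|k]|k] /=; rewrite ?opprK //.
by rewrite /Psi_sum !big_ord0 oppr0.
Qed.

Lemma brW_tD r s f g a b :
  brW (tD r f, a) (tD s g, b) =
  (tD (r + s) (pshift s f * g - f * pshift r g),
   if r + s == 0 then Psi_hom r f g else 0).
Proof.
by rewrite /brW /= !dop_mul_tD Psi_tD [s + r]addrC raddfB /= [pshift r g * f]mulrC.
Qed.

Lemma dtnE n : dtn n = tD (- n%:Z) (ffactp n).
Proof.
elim: n => [|n IHn]; first by rewrite /ffactp big_ord0.
rewrite /dtn iterS -/(dtn n) IHn dop_mul_tD /ffactp big_ord_recr /= /pshift.
rewrite comp_polyX mulrC intS opprD rmorphN polyCN.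
by congr (tD _ (_ * ('X - _%:P))); rewrite -pmulrn.
Qed.

(* The action on Laurent polynomials: t^k f(D) maps t^m to f(m) t^(m+k). *)
Definition dop_act x (q : {malg C[int]}) : {malg C[int]} :=
  \sum_(k <- msupp x) \sum_(m <- msupp q)
     << (x@_k).[m%:~R] * q@_m *g k + m >>.

Let actF k (m : int) f (a : C) : {malg C[int]} := << f.[m%:~R] * a *g k + m >>.

Let actFDl k m a : {morph actF k m ^~ a : f f' / f + f'}.
Proof. by move=> f f'; rewrite /actF hornerD mulrDl monalgUD. Qed.

Let actFDr k m f : {morph actF k m f : a a' / a + a'}.
Proof. by move=> a a'; rewrite /actF mulrDr monalgUD. Qed.

Lemma dop_actU k f m a :
  dop_act (tD k f) << a *g m >> = << f.[m%:~R] * a *g k + m >>.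
Proof. exact: (bilin_sumU actFDl actFDr). Qed.

Lemma dop_actDl x y q : dop_act (x + y) q = dop_act x q + dop_act y q.
Proof. exact: (bilin_sumDl actFDl actFDr). Qed.

Lemma dop_actDr x q q' : dop_act x (q + q') = dop_act x q + dop_act x q'.
Proof. exact: (bilin_sumDr actFDl actFDr). Qed.

Lemma dop_act0l q : dop_act 0 q = 0.
Proof. exact: (bilin_sum0l actF). Qed.

Lemma dop_act0r x : dop_act x 0 = 0.
Proof. exact: (bilin_sum0r actF). Qed.

Lemma dop_ind (P : dop C -> Prop) :
    P 0 -> (forall x y, P x -> P y -> P (x + y)) ->
    (forall r f, P (tD r f)) -> forall x, P x.
Proof. by move=> P0 PD PU x; rewrite (dopE x); elim/big_ind: _. Qed.

Lemma dop_act_mul x y q : dop_act (dop_mul x y) q = dop_act x (dop_act y q).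
Proof.
elim/dop_ind: x => [|x x' IHx IHx'|r f].
- by rewrite dop_mul0l !dop_act0l.
- by rewrite dop_mulDl !dop_actDl IHx IHx'.
elim/dop_ind: y => [|y y' IHy IHy'|s g].
- by rewrite dop_mul0r !dop_act0l dop_act0r.
- by rewrite dop_mulDr !dop_actDl dop_actDr IHy IHy'.
rewrite dop_mul_tD (monalgE q); elim/big_ind: _ => [|q1 q2 e1 e2|m _].
- by rewrite !dop_act0r.
- by rewrite !dop_actDr e1 e2.
rewrite !dop_actU hornerM horner_pshift addrA -mulrA.
by rewrite -intrD [s + m]addrC.
Qed.

Lemma dop_act1 q : dop_act (tD 0 1) q = q.
Proof.
rewrite (monalgE q); elim/big_ind: _ => [|q1 q2 e1 e2|m _].
  exact: dop_act0r.
  by rewrite dop_actDr e1 e2.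
by rewrite dop_actU hornerC mul1r add0r.
Qed.

Lemma dop_actU_coef x (m j : int) :
  (dop_act x << 1 *g m >>)@_(j + m) = (x@_j).[m%:~R].
Proof.
elim/dop_ind: x => [|x y IHx IHy|r f].
- by rewrite dop_act0l !mcoeff0 horner0.
- by rewrite dop_actDl !mcoeffD IHx IHy hornerD.
rewrite dop_actU mulr1 !mcoeffU (inj_eq (addIr m)).
by case: eqP => _; rewrite ?mulr1n // !mulr0n horner0.
Qed.

Lemma dop_act_inj : [pchar C] =i pred0 -> injective dop_act.
Proof.
move=> C0 x y exy; apply/malgP => j; apply/eqP; rewrite -subr_eq0.
pose d : {poly C} := x@_j - y@_j; rewrite -/d; apply/negPn/negP => nz.
pose rs := [seq (i%:R : C) | i <- iota 0 (size d)].
have /negP[] : ~~ (size rs < size d)%N by rewrite size_map size_iota ltnn.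
apply: max_poly_roots nz _ _.
  apply/allP => _ /mapP[i _ ->]; rewrite /root /d hornerD hornerN.
  by rewrite (pmulrn 1 i) -!dop_actU_coef exy subrr.
suff inj a b : a%:R = b%:R :> C -> (a <= b)%N -> a = b.
  have natI : injective (fun i => i%:R : C); last first.
    by rewrite map_inj_uniq ?iota_uniq.
  move=> a b eab.
  have [ab|/ltnW ab] := leqP a b; first exact: inj.
  exact/esym/inj.
move=> eab leab; apply/eqP; rewrite eqn_leq leab -subn_eq0.
by rewrite andTb -(iffLR (pcharf0P C) C0) natrB // eab subrr.
Qed.

Lemma dop_mulA : associative dop_mul.
Proof.
move=> x y z; elim/dop_ind: x => [|x x' IHx IHx'|r f].
- by rewrite !dop_mul0l.
- by rewrite !dop_mulDl IHx IHx'.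
elim/dop_ind: y => [|y y' IHy IHy'|s g].
- by rewrite dop_mul0r !dop_mul0l dop_mul0r.
- by rewrite dop_mulDr !dop_mulDl dop_mulDr IHy IHy'.
elim/dop_ind: z => [|z z' IHz IHz'|k h].
- by rewrite !dop_mul0r.
- by rewrite !dop_mulDr IHz IHz'.
rewrite !dop_mul_tD pshiftM !mulrA !addrA; congr (tD _ (_ * _ * _)).
rewrite /pshift -comp_polyA comp_polyD comp_polyX comp_polyC.
by rewrite -addrA -polyCD -intrD [k + s]addrC.
Qed.

Lemma ffactp_monic n : ffactp n \is monic.
Proof. by apply: monic_prod => i _; exact: monicXsubC. Qed.

Lemma pshiftK s : cancel (pshift s) (pshift (- s)).
Proof.
move=> f; rewrite /pshift -comp_polyA comp_polyD comp_polyX comp_polyC.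
by rewrite -addrA -polyCD -intrD addNr addr0 comp_polyXr.
Qed.

Lemma Winf_gr_sub n j : Winf_gr n j `<=` Winf n.
Proof.
case=> x c [[f /= ->] _]; exists (tD (j + n%:Z) (pshift n%:Z f)).
by rewrite dtnE dop_mul_tD addrK pshiftK.
Qed.

Lemma WinfP n (u : What) :
  Winf n u <-> forall j, exists f, (u.1)@_j = f * ffactp n.
Proof.
split=> [[x ->] j|h].
  rewrite dtnE; elim/dop_ind: x j => [|x x' IHx IHx'|r f] j.
  - by exists 0; rewrite dop_mul0l mcoeff0 mul0r.
  - have [[f e] [f' e']] := (IHx j, IHx' j).
    by exists (f + f'); rewrite dop_mulDl mcoeffD e e' mulrDl.
  rewrite dop_mul_tD mcoeffU; case: eqP => _; first by eexists; rewrite mulr1n.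
  by exists 0; rewrite mulr0n mul0r.
suff [x ex] : exists x, u.1 = dop_mul x (dtn n) by exists x.
rewrite (dopE u.1); elim/big_ind: _ => [|x y [x' ->] [y' ->]|j _].
- by exists 0; rewrite dop_mul0l.
- by exists (x' + y'); rewrite dop_mulDl.
have [f ->] := h j.
have [|x /= ex] := @Winf_gr_sub n j (tD j (f * ffactp n), 0); last by exists x.
by split=> //; exists f.
Qed.

Lemma tDZ (a : C) k f : a *: tD k f = tD k (a *: f).
Proof.
apply/malgP => j; rewrite -[a *: f]mul_polyC.
have -> : a *: tD k f = a%:P *: (tD k f : {malg {poly C}[int]}) by [].
by rewrite mcoeffZ !mcoeffU mulrnAr.
Qed.

Lemma dop_mulZl (a : C) x y : dop_mul (a *: x) y = a *: dop_mul x y.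
Proof.
elim/dop_ind: x => [|x x' IHx IHx'|r f].
- by rewrite scaler0 !dop_mul0l scaler0.
- by rewrite scalerDr !dop_mulDl scalerDr IHx IHx'.
elim/dop_ind: y => [|y y' IHy IHy'|s g].
- by rewrite !dop_mul0r scaler0.
- by rewrite !dop_mulDr scalerDr IHy IHy'.
by rewrite tDZ !dop_mul_tD tDZ /pshift comp_polyZ scalerAl.
Qed.

Lemma Winf_parabolic n : W_parabolic n (Winf n).
Proof.
split.
- split=> //.
  + split; first by exists 0; rewrite dop_mul0l.
    move=> a u v [x ux] [y vy]; exists (a *: x + y).
    by rewrite dop_mulDl dop_mulZl -ux -vy.
  move=> u v [x ux] [y vy]; exists (dop_mul u.1 y - dop_mul v.1 x).
  have mulN z z' : dop_mul (- z) z' = - dop_mul z z'.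
    by rewrite -scaleN1r dop_mulZl scaleN1r.
  by rewrite /= dop_mulDl mulN -!dop_mulA -ux -vy.
- move=> [x c] /WinfP /= h.
  exists ((0, c) :: [seq (tD j x@_j, 0) | j <- msupp x]); split.
    have gr_in (v : What) j : Winf_gr n j v -> exists j, hcomp (Winf_gr n) (Winf n) j v.
      by move=> vj; exists j; split=> //; exact: Winf_gr_sub vj.
    move=> v; rewrite inE => /orP[/eqP ->|/mapP[j _ ->]].
      by apply: (gr_in _ 0); split; [exists 0; rewrite mul0r raddf0 | rewrite eqxx].
    by apply: (gr_in _ j); split=> //=; have [f ->] := h j; exists f.
  rewrite big_cons big_map [in LHS](dopE x).
  have -> : \sum_(j <- msupp x) ((tD j x@_j, 0) : What) =
            (\sum_(j <- msupp x) tD j x@_j, 0).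
    apply: (big_ind2 (fun (u : What) z => u = (z, 0))) => // _ z _ z' -> ->.
    by congr pair; rewrite addr0.
  by congr pair; rewrite /= ?add0r ?addr0.
- by move=> j _; apply/seteqP; split=> [u []//|u uj]; split=> //; exact: Winf_gr_sub uj.
exists (- 1) => // e.
pose u : What := (tD (- 1) (ffactp n), 0).
have : hcomp (Winf_gr n) (Winf n) (- 1) u.
  have uj : Winf_gr n (- 1) u by split=> //; exists 1; rewrite mul1r.
  by split=> //; exact: Winf_gr_sub uj.
rewrite e => /(congr1 (fun v : What => v.1)) /= /eqP; rewrite /tD monalgU_eq0.
by rewrite (negPf (monic_neq0 (ffactp_monic n))).
Qed.

Lemma IcoefP n (p : set What) (k : nat) : (0 < k)%N ->
  hcomp (Winf_gr n) p (- k%:Z) =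
  [set u | exists2 f, Icoef n p k f & u = (tD (- k%:Z) f, 0)].
Proof.
move=> k0; apply/seteqP; split=> [[x c] h|u [f h ->]] //.
have [_ [[f /= xf] c0]] := h.
have {}c0 : c = 0 by apply: c0; rewrite oppr_eq0; case: k k0 {h xf}.
by exists (f * ffactp n); rewrite ?/Icoef /= -?xf -?c0.
Qed.

Lemma Icoef_sub n (p : set What) (k : nat) f :
  Icoef n p k f -> exists f', f = f' * ffactp n.
Proof.
case=> _ [[f' /= e] _]; exists f'.
by rewrite -[f](mcoeffUU (- k%:Z)) -[LHS]/((tD (- k%:Z) f)@_(- k%:Z)) e mcoeffUU.
Qed.

End DifferentialOperators.

(* Main.v *)
Require Import Defs.
From mathcomp Require Import all_boot all_order all_algebra complex.
From mathcomp Require Import classical_sets reals.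
From mathcomp Require Import finmap monalg boolp zify ring.
Import GRing.Theory Num.Theory.
Local Open Scope ring_scope.
Local Open Scope classical_set_scope.

Set Implicit Arguments.
Unset Strict Implicit.

(** Everything in degree 0 belongs to a parabolic subalgebra, and bracketing
    with F(D) in degree 0 acts on degree -k by
      [F(D), t^-k f(D)] = t^-k (F(D - k) - F(D)) f(D),
    so I_{-k} is stable under multiplication by F(w - k) - F(w) for every
    multiple F of [w]_n ([Icoef_shift_mul]).

    For n <= 2, F = w (w - 1) is such a multiple and F(w - k) - F(w) has degree
    exactly 1; a subspace stable under multiplication by a polynomial of degree
    1 is stable under w, hence is an ideal ([Icoef_ideal]).  For arbitrary n,
    the multiples of [w]_n reach every degree >= n, and the difference lowers
    the degree by exactly one; multiplying them by one nonzero element of I_{-k}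
    gives elements of I_{-k} of every large enough degree, and such a subspace
    has finite codimension ([Icoef_finite_codim]).

    For n > 2, all the multipliers F(w - 1) - F(w) vanish at 1 and at 2, since F
    vanishes at 0, 1 and 2.  So multiplication by them preserves the space of
    all [w]_n q with q(1) = q(2), which is not an ideal.  It remains to see that
    this space is the I_{-1} of some parabolic subalgebra.  Put b = [w]_n and
    take, for k >= 2, the ideal I_{-k} generated by b(w) b(w-1) ... b(w-k+1);
    t^-k b(D) b(D-1) ... b(D-k+1) is the k-th power of the operator t^-1 b(D),
    which makes these ideals multiplicative ([shift_prod_dvd]).  A bracket from
    degrees j and -j-1 has the form t^-1 q(D) b(D), and the factors of b present
    in both terms force q(1) = q(2) = 0 ([bracket_degree_m1]), so the condition
    on I_{-1} is respected. *)

(** * Shifts of polynomials *)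

Section Shifts.
Variable C : fieldType.
Implicit Types (f g b : {poly C}) (r s : int).

Lemma pshift_comp r s f : pshift s (pshift r f) = pshift (r + s) f.
Proof.
rewrite /pshift -comp_polyA comp_polyD comp_polyX comp_polyC.
by rewrite -addrA -polyCD -intrD [s + r]addrC.
Qed.

Lemma pshift0 f : pshift 0 f = f.
Proof. by rewrite /pshift addr0 comp_polyXr. Qed.

Lemma pshift1 s : pshift s (1 : {poly C}) = 1.
Proof. exact: comp_polyC. Qed.

Lemma dvdp_pshift s f g : f %| g -> pshift s f %| pshift s g.
Proof. by case/dvdpP=> q ->; rewrite pshiftM dvdp_mull. Qed.

Lemma pshift_taylor s f :
  pshift s f = \sum_(i < size f) (s%:~R ^+ i) *: f^`N(i).
Proof.
have -> : pshift s f = f^:P.['X + (s%:~R)%:P] by [].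
rewrite nderiv_taylor; last exact: mulrC.
rewrite size_map_polyC; apply: eq_bigr => i _.
rewrite nderivn_map -/(comp_poly 'X f^`N(i)) comp_polyXr.
by rewrite -rmorphXn /= mulrC mul_polyC.
Qed.

Lemma shift_diff_coef s f j :
  (pshift s f - f)`_j =
  \sum_(i < (size f).-1) s%:~R ^+ i.+1 * (f`_(i.+1 + j) *+ 'C(i.+1 + j, i.+1)).
Proof.
rewrite coefB pshift_taylor coef_sum.
case: (size f) (size_poly_eq0 f) => [/esym/eqP ->|m _].
  by rewrite !big_ord0 coef0 subrr.
rewrite big_ord_recl expr0 scale1r nderivn0 addrC addKr /=.
by apply: eq_bigr => i _; rewrite coefZ coef_nderivn.
Qed.

End Shifts.

(** In characteristic 0 a nonzero shift difference lowers the degree by exactly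
    one: its coefficient in degree d is (d + 1) s times the leading coefficient
    of f. *)
Lemma size_shift_diff (C : numFieldType) (s : int) (f : {poly C}) (d : nat) :
  s != 0 -> size f = d.+2 -> size (pshift s f - f) = d.+1.
Proof.
move=> s0 fd; apply/eqP; rewrite eqn_leq; apply/andP; split.
  apply/leq_sizeP => j ltdj; rewrite shift_diff_coef big1 // => i _.
  rewrite nth_default ?mul0rn ?mulr0 // [leqLHS]fd addSn ltnS.
  by rewrite (leq_trans ltdj) ?leq_addl.
suff nz : (pshift s f - f)`_d != 0.
  by rewrite ltnNge; apply: contraNN nz => le; rewrite nth_default.
(* Only the first-order Taylor term reaches degree d. *)
rewrite shift_diff_coef fd big_ord_recl big1 => [|i _]; last first.
  by rewrite lift0 nth_default ?mul0rn ?mulr0 // fd !addSn !ltnS leq_addl.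
rewrite addr0 expr1 add1n bin1 mulf_neq0 ?intr_eq0 //.
rewrite -mulr_natr mulf_neq0 //; last by rewrite pnatr_eq0.
have -> : f`_d.+1 = lead_coef f by rewrite lead_coefE fd.
by rewrite lead_coef_eq0 -size_poly_eq0 fd.
Qed.

(** * Ideals and finite codimension in C[w] *)

Section Subspaces.
Variable C : fieldType.
Implicit Types (f g : {poly C}) (S : set {poly C}).

Lemma mulX_closed_ideal S :
    is_subspace S -> (forall f, S f -> S ('X * f)) ->
  is_ideal S.
Proof.
case=> S0 SD SX; split=> // [f g Sf Sg|a f Sf].
  by rewrite -[f]scale1r; exact: SD.
elim/poly_ind: a => [|a c IHa]; first by rewrite mul0r.
rewrite mulrDl addrC mul_polyC [a * 'X]mulrC -mulrA.
by apply: SD => //; exact: SX.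
Qed.

(** Subtracting elements of S one leading term at a time brings every
    polynomial below degree N, where the powers of w of exponent < N span. *)
Lemma finite_codim_degrees S (N : nat) :
    is_subspace S ->
    (forall d, (N <= d)%N -> exists2 f, S f & size f = d.+1) ->
  finite_codim S.
Proof.
move=> [S0 SD] degS; exists (mkseq (fun i => 'X^i : {poly C}) N) => v.
have [m] := ubnP (size v); elim: m v => // m IHm v ltvm.
have [leN|ltN] := leqP (size v) N.
  exists 0, (fun i => v`_i); split=> //; rewrite add0r size_mkseq.
  transitivity (\poly_(i < N) v`_i).
    apply/polyP => i; rewrite coef_poly; case: ltnP => // leNi.
    by rewrite nth_default // (leq_trans leN).
  rewrite poly_def; apply: eq_bigr => i _.
  by rewrite nth_mkseq.
have [d vd] : exists d, size v = d.+1 by case: (size v) ltN => // d _; exists d.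
have [|f Sf fd] := degS d; first by rewrite -ltnS -vd.
pose a := lead_coef v / lead_coef f.
have f0 : lead_coef f != 0 by rewrite lead_coef_eq0 -size_poly_eq0 fd.
have [|u [c [Su vE]]] := IHm (v - a *: f).
  apply: leq_trans (_ : d.+1 <= m)%N; last by rewrite -ltnS -vd.
  rewrite ltnS; apply/leq_sizeP => j; rewrite leq_eqVlt coefB coefZ.
  case: eqP => [<- _|_ ltdj] /=.
    rewrite -[d in v`_d]/(d.+1.-1) -vd -[d in f`_d]/(d.+1.-1) -fd.
    by rewrite -!lead_coefE /a divfK ?subrr.
  by rewrite !nth_default ?mulr0 ?subrr // ?vd ?fd.
exists (a *: f + u), c; split; first exact: SD.
by rewrite -addrA -vE addrC subrK.
Qed.

End Subspaces.

(** * Falling factorials *)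

Section FallingFactorial.
Variable C : fieldType.
Implicit Types f : {poly C}.

Lemma ffactp_root n (i : nat) : (i < n)%N -> (ffactp C n).[i%:R] = 0.
Proof.
move=> ltin; rewrite /ffactp horner_prod (bigD1 (Ordinal ltin)) //=.
by rewrite hornerXsubC subrr mul0r.
Qed.

Lemma dvdp_ffactp_root n (i : nat) f :
  (i < n)%N -> ffactp C n %| f -> f.[i%:R] = 0.
Proof.
by move=> ltin /dvdpP[q ->]; rewrite hornerM ffactp_root ?mulr0.
Qed.

Lemma dvdp_ffactpP n f : ffactp C n %| f <-> exists q, f = q * ffactp C n.
Proof. by split=> [/dvdpP[q ->]|[q ->]]; [exists q | exact: dvdp_mull]. Qed.

Lemma size_ffactp n : size (ffactp C n) = n.+1.
Proof. by rewrite size_prod_XsubC /index_enum -enumT size_enum_ord. Qed.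

End FallingFactorial.

(** * The action of degree 0 on a parabolic subalgebra *)

Section DegreeZeroAction.
Variable C : numFieldType.
Implicit Types (f F : {poly C}) (p : set (What C)).

Lemma Icoef_subspace n p k :
  (0 < k)%N -> W_parabolic n p -> is_subspace (Icoef n p k : set {poly C}).
Proof.
move=> k0 [[[p0 pD] _ _] _ _ _].
have gr f : ffactp C n %| f ->
    Winf_gr n (- k%:Z) (tD (- k%:Z) f, 0 : C^o).
  by move/dvdp_ffactpP=> [q ->]; split=> //; exists q.
have Ip f : p (tD (- k%:Z) f, 0) -> ffactp C n %| f -> Icoef n p k f.
  by move=> pf nf; split=> //; exact: gr.
split; first by apply: Ip; rewrite ?dvdp0 ?raddf0.
move=> a f g If Ig; have [[pf _] [pg _]] := (If, Ig).
apply: Ip; last first.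
  have [[q ->] [q' ->]] := (Icoef_sub If, Icoef_sub Ig).
  by rewrite scalerAl -mulrDl dvdp_mull.
have := pD a _ _ pf pg.
suff -> : a *: (tD (- k%:Z) f, 0) + (tD (- k%:Z) g, 0) =
          (tD (- k%:Z) (a *: f + g), 0) :> What C by [].
by congr pair; rewrite /= ?tDZ ?raddfD //= scaler0 addr0.
Qed.

(** This is the bracket of F(D), which has degree 0 and so lies in p, with
    t^-k f(D). *)
Lemma Icoef_shift_mul n p k F f : (0 < k)%N -> W_parabolic n p ->
    ffactp C n %| F -> Icoef n p k f ->
  Icoef n p k ((pshift (- k%:Z) F - F) * f).
Proof.
move=> k0 [[_ _ pbr] _ pge0 _] /dvdp_ffactpP[q Fq] If; have [pf _] := If.
have p0F : p (tD 0 F, 0).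
  suff : hcomp (Winf_gr n) p 0 (tD 0 F, 0) by case.
  by rewrite pge0 //; split=> //; exists q; rewrite Fq.
have := pbr _ _ p0F pf; rewrite brW_tD !add0r pshift0 -mulrBl.
rewrite oppr_eq0 eqz_nat eqn0Ngt k0 => pFf; split=> //; split=> //=.
by have [q' ->] := Icoef_sub If; eexists; rewrite mulrA.
Qed.

Lemma Icoef_ideal n p k : (n <= 2)%N -> (0 < k)%N -> W_parabolic n p ->
  is_ideal (Icoef n p k : set {poly C}).
Proof.
move=> n_le2 k0 Wp; have subI := Icoef_subspace k0 Wp.
apply: mulX_closed_ideal => // f If.
(* The same F = w (w - 1) serves for all n <= 2. *)
pose F : {poly C} := 'X * ('X - 1).
have bF : ffactp C n %| F.
  apply/dvdp_ffactpP; case: n n_le2 {Wp subI If} => [|[|[|//]]] _;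
    rewrite /ffactp ?big_ord_recl ?big_ord0.
  - by exists F; rewrite mulr1.
  - by exists ('X - 1); rewrite /F /= subr0; ring.
  by exists 1; rewrite /F /= subr0 mulr1 mul1r.
have := Icoef_shift_mul k0 Wp bF If.
have k0' : - (k%:R *+ 2) != 0 :> C by rewrite oppr_eq0 -mulrnA pnatr_eq0; lia.
set h := pshift _ F - F => Ihf.
have hE : h = (- (k%:R *+ 2))%:P * 'X + (k%:R ^+ 2 + k%:R)%:P.
  rewrite /h /F /pshift comp_polyM comp_polyB comp_polyX comp_polyC.
  rewrite rmorphN /= -pmulrn !(polyCN, polyCD, polyCM, polyCMn, rmorphXn) /=.
  by ring.
have -> : 'X * f = (- (k%:R *+ 2))^-1 *: (h * f) +
    (- ((- (k%:R *+ 2))^-1 * (k%:R ^+ 2 + k%:R))) *: f.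
  rewrite hE mulrDl scalerDr -mulrA !mul_polyC !scalerA mulVf // scale1r.
  by rewrite scaleNr addrK.
have [I0 ID] := subI; apply: (ID) => //.
by rewrite -[_ *: f]addr0; exact: ID.
Qed.

Lemma Icoef_finite_codim n p k : (0 < n)%N -> (0 < k)%N -> W_parabolic n p ->
    Icoef n p k <> [set 0 : {poly C}] ->
  finite_codim (Icoef n p k : set {poly C}).
Proof.
move=> n0 k0 Wp Inz; have subI := Icoef_subspace k0 Wp.
have [g Ig g0] : exists2 g, Icoef n p k g & g != 0.
  apply: contrapT => noI; apply: Inz; apply/seteqP; split=> [g Ig|_ ->] /=.
    by apply: contrapT => /eqP g0; apply: noI; exists g.
  by have [] := subI.
apply: (@finite_codim_degrees _ _ (size g + n)%N) => // d led.
(* The exponent makes (F(w - k) - F(w)) g have degree d. *)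
pose F : {poly C} := ffactp C n * 'X^(d - size g - n + 2).
have sF : size F = (d - size g).+3.
  rewrite size_Mmonic ?monicXn ?monic_neq0 ?ffactp_monic //.
  by rewrite size_ffactp size_polyXn; lia.
exists ((pshift (- k%:Z) F - F) * g).
  by apply: Icoef_shift_mul => //; exact: dvdp_mulr.
have sh : size (pshift (- k%:Z) F - F) = (d - size g).+2.
  by apply: size_shift_diff => //; lia.
rewrite size_mul // -?size_poly_eq0 ?sh //.
by rewrite addSn addSn /= subnK ?(leq_trans (leq_addr n _) led).
Qed.

End DegreeZeroAction.

(** * Parabolic subalgebras with prescribed components *)

Section PrescribedComponents.
Variable C : fieldType.
Implicit Types (f g : {poly C}) (r s j : int).

Definition dop_comps (J : int -> set {poly C}) : set (What C) :=
  [set u | forall j, J j (u.1)@_j].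

Variables (n : nat) (J : int -> set {poly C}).
Hypothesis J_sub : forall j, is_subspace (J j).
Hypothesis J_dvd : forall j f, J j f -> ffactp C n %| f.

Lemma dop_comps_tD j f (c : C^o) : J j f -> dop_comps J (tD j f, c).
Proof.
move=> Jf i /=; rewrite mcoeffU; case: eqP => [<- //|_].
by have [] := J_sub i.
Qed.

Lemma Icoef_dop_comps k f : (0 < k)%N ->
  Icoef n (dop_comps J) k f <-> J (- k%:Z) f.
Proof.
move=> k0; split=> [[/(_ (- k%:Z)) /= + _]|Jf]; first by rewrite mcoeffUU.
split; first exact: dop_comps_tD.
by split=> //; have /dvdp_ffactpP[q ->] := J_dvd Jf; exists q.
Qed.

(** A family J closed under the homogeneous brackets defines a subalgebra, as
    the bracket is the sum of the brackets of the homogeneous terms.  The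
    values of the cocycle lie in it since it contains the centre, which has
    degree 0. *)
Lemma dop_comps_parabolic :
    (forall j f, 0 <= j -> ffactp C n %| f -> J j f) ->
    (exists j f, [/\ j < 0, J j f & f != 0]) ->
    (forall r s f g, J r f -> J s g ->
       J (r + s) (pshift s f * g - f * pshift r g)) ->
  W_parabolic n (dop_comps J).
Proof.
move=> J_ge0 [j0 [f0 [j0lt Jf0 f0nz]]] J_br.
have JD j f g : J j f -> J j g -> J j (f + g).
  by move=> Jf Jg; rewrite -[f]scale1r; apply: (J_sub j).2.
have Jsum j (I : choiceType) (e : {fset I}) (x : I -> dop C) :
    (forall i, J j (x i)@_j) -> J j (\sum_(i <- e) x i)@_j.
  move=> Jx; elim/big_ind: _ => // [|x' y' Jx' Jy'].
    by rewrite mcoeff0; have [] := J_sub j.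
  by rewrite mcoeffD; exact: JD.
have dvd_gr u j : dop_comps J u -> Winf_gr n j (tD j (u.1)@_j, 0 : C^o).
  by move=> /(_ j)/J_dvd/dvdp_ffactpP[q ->]; split=> //; exists q.
split.
- split.
  + split=> [j|a u v Ju Jv j]; first by rewrite mcoeff0; have [] := J_sub j.
    have -> : (a *: u + v).1@_j = a *: (u.1)@_j + (v.1)@_j.
      by rewrite mcoeffD -mul_polyC -mcoeffZ.
    exact: (J_sub j).2.
  + by move=> u Ju; apply/WinfP => j; apply/dvdp_ffactpP; exact: J_dvd (Ju j).
  move=> [x a] [y b] Jx Jy j /=.
  have -> : dop_mul x y - dop_mul y x =
      \sum_(r <- msupp x) \sum_(s <- msupp y)
         tD (r + s) (pshift s x@_r * y@_s - x@_r * pshift r y@_s) :> dop C.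
    rewrite {1 2}/dop_mul [X in _ - X]exchange_big -sumrB /=.
    apply: eq_bigr => r _; rewrite -sumrB; apply: eq_bigr => s _.
    by rewrite raddfB [s + r]addrC [x@_r * _]mulrC.
  apply: (Jsum) => r; apply: (Jsum) => s; rewrite mcoeffU.
  case: eqP => [<-|_]; first by rewrite mulr1n; exact: J_br.
  by have [] := J_sub j.
- move=> [x c] Jx.
  exists ((0, c) :: [seq (tD j x@_j, 0) | j <- msupp x]); split.
    move=> v; rewrite inE => /orP[/eqP ->|/mapP[j _ ->]].
      exists 0; split; first by move=> j; rewrite mcoeff0; have [] := J_sub j.
      by split=> //; exists 0; rewrite mul0r raddf0.
    by exists j; split; [exact: dop_comps_tD | exact: dvd_gr Jx].
  have sumE : \sum_(j <- msupp x) ((tD j x@_j, 0) : What C) = (x, 0).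
    rewrite [in RHS](dopE x).
    apply: (big_ind2 (fun (u : What C) z => u = (z, 0))) => // _ z _ z' -> ->.
    by congr pair; rewrite addr0.
  by rewrite big_cons big_map sumE; congr pair; rewrite /= ?add0r ?addr0.
- move=> j j_ge0; apply/seteqP; split=> [u []//|[x c] uj]; split=> //.
  have [[q /= ->] _] := uj; apply: dop_comps_tD; apply: J_ge0 => //.
  exact: dvdp_mull.
exists j0 => // e.
have : hcomp (Winf_gr n) (dop_comps J) j0 (tD j0 f0, 0).
  split; first exact: dop_comps_tD.
  by have /dvdp_ffactpP[q ->] := J_dvd Jf0; split=> //; exists q.
rewrite e => /(congr1 (fun v : What C => v.1)) /= /eqP.
by rewrite /tD monalgU_eq0; exact/negP.
Qed.

End PrescribedComponents.

(** * A parabolic subalgebra whose component in degree -1 is no ideal *)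

Section ShiftProducts.
Variable C : fieldType.
Implicit Types (b : {poly C}) (r s : int).

(** The coefficient of t^-k in the k-th power of t^-1 b(D). *)
Definition shift_prod b (k : nat) : {poly C} := \prod_(i < k) pshift (- i%:Z) b.

Definition negpart (j : int) : nat := if j is Negz k then k.+1 else 0.

Lemma negpart_subn (k l : nat) : negpart (k%:Z - l%:Z) = (l - k)%N.
Proof. by case E: (k%:Z - l%:Z) => [m|m] /=; lia. Qed.

Lemma pshift_shift_prod s b k :
  pshift s (shift_prod b k) = \prod_(i < k) pshift (s - i%:Z) b.
Proof.
rewrite (big_morph _ (pshiftM s) (pshift1 C s)); apply: eq_bigr => i _.
by rewrite pshift_comp addrC.
Qed.

Lemma shift_prodD b k l :
  shift_prod b (k + l) = shift_prod b k * pshift (- k%:Z) (shift_prod b l).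
Proof.
rewrite pshift_shift_prod /shift_prod big_split_ord; congr (_ * _).
by apply: eq_bigr => i _; congr pshift => /=; lia.
Qed.

Lemma shift_prod1 b : shift_prod b 1 = b.
Proof. by rewrite /shift_prod big_ord1 oppr0 pshift0. Qed.

(** Write B_j for [shift_prod b (negpart j)].  In negative degrees the
    divisibility is an equality, the product of two powers of t^-1 b(D); in the
    mixed cases the factors of B_(r+s) are among those of the factor coming from
    the negative degree. *)
Lemma shift_prod_dvd b r s :
  shift_prod b (negpart (r + s)) %|
    pshift s (shift_prod b (negpart r)) * shift_prod b (negpart s).
Proof.
case: r s => k [l|l]; rewrite ?NegzE.
- by rewrite /= /shift_prod big_ord0 dvd1p.
- rewrite negpart_subn /=.
  rewrite [X in _ %| _ * shift_prod b X](_ : _ = (l.+1 - k) + minn k l.+1)%N;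
    last lia.
  by rewrite shift_prodD; apply/dvdp_mull/dvdp_mulr.
- rewrite addrC negpart_subn /=.
  rewrite [X in _ %| pshift _ (shift_prod b X) * _]
    (_ : _ = minn l k.+1 + (k.+1 - l))%N; last lia.
  rewrite shift_prodD pshiftM pshift_comp; apply/dvdp_mulr.
  have [le|lt] := leqP l k.+1; last first.
    rewrite (_ : (k.+1 - l) = 0)%N; last lia.
    by rewrite {1}/shift_prod big_ord0 dvd1p.
  by rewrite addNr pshift0 dvdp_mull.
rewrite -opprD -PoszD addnC -[- _](add0r) negpart_subn subn0 shift_prodD /=.
by rewrite mulrC; exact: dvdpp.
Qed.

End ShiftProducts.

Section TwistedParabolic.
Variable C : numFieldType.
Implicit Types (f g q F G H : {poly C}) (r s j : int).
Variable n : nat.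
Local Notation b := (ffactp C n).

(** Besides the divisibility conditions, which cut out ideals, the condition
    q(1) = q(2) in degree -1 is what destroys stability under w. *)
Definition twisted_comp (j : int) : set {poly C} :=
  [set f | [/\ b %| f, shift_prod b (negpart j) %| f &
     j = - 1 -> exists2 q, f = q * b & q.[1] = q.[2%:R]]].

Lemma twisted_comp_subspace j : is_subspace (twisted_comp j).
Proof.
split=> [|a f g [f1 f2 f3] [g1 g2 g3]].
  by split; rewrite ?dvdp0 // => _; exists 0; rewrite ?mul0r ?horner0.
split; try by rewrite dvdp_add // -mul_polyC dvdp_mull.
move=> /[dup] /f3[q -> q12] /g3[q' -> q12']; exists (a *: q + q').
  by rewrite mulrDl scalerAl.
by rewrite !hornerD !hornerZ q12 q12'.
Qed.

Lemma twisted_comp_ffactp : twisted_comp (- 1) b.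
Proof.
split=> /=; rewrite ?shift_prod1 // => _.
by exists 1; rewrite ?mul1r ?hornerC.
Qed.

Lemma twisted_not_ideal :
  ~ is_ideal (Icoef n (dop_comps twisted_comp) 1 : set {poly C}).
Proof.
have IP f : Icoef n (dop_comps twisted_comp) 1 f <-> twisted_comp (- 1) f.
  by apply: Icoef_dop_comps => // [|j g []//]; exact: twisted_comp_subspace.
case=> _ _ /(_ 'X b) /(_ (iffRL (IP b) twisted_comp_ffactp)).
move=> /(iffLR (IP _)) [_ _ [//|q /mulIf <-]].
  by rewrite !hornerX => /eqP; rewrite -[X in X == _]/(1%:R) eqr_nat.
exact: monic_neq0 (ffactp_monic _ n).
Qed.

Hypothesis n_gt2 : (2 < n)%N.

(** In the quotient by b, each of the two terms vanishes at 1 and 2: the second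
    has the factor F(w), divisible by b; the first has, beyond one factor b(w),
    the factor b(w - 1) contributed by G when j > 0 and by F(w - 1) when
    j = 0.  Here b vanishes at 0, 1 and 2, which is where n > 2 enters. *)
Lemma bracket_degree_m1 (j : nat) F G :
    b %| F -> shift_prod b j.+1 %| G ->
  exists2 q, pshift (- j.+1%:Z) F * G - F * pshift j%:Z G = q * b &
    q.[1] = q.[2%:R].
Proof.
move=> bF /dvdpP[H GE].
have G1 : G = H * pshift (- 1) (shift_prod b j) * b.
  by rewrite GE -add1n shift_prodD shift_prod1; ring.
have G2 : pshift j%:Z G = pshift j%:Z H * pshift j%:Z (shift_prod b j) * b.
  rewrite GE -addn1 shift_prodD shift_prod1 !pshiftM pshift_comp addNr.
  by rewrite pshift0 mulrA.
pose q := pshift (- j.+1%:Z) F * (H * pshift (- 1) (shift_prod b j)) -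
          F * (pshift j%:Z H * pshift j%:Z (shift_prod b j)).
exists q; first by rewrite G2 {1}G1 /q; ring.
have q0 i : (i < 2)%N -> q.[i.+1%:R] = 0.
  move=> lti; rewrite /q hornerD hornerN !hornerM !horner_pshift.
  rewrite (dvdp_ffactp_root _ bF) ?mul0r ?subr0; last exact: leq_trans n_gt2.
  have -> : i.+1%:R + (- 1)%:~R = i%:R :> C by rewrite -addn1 natrD addrK.
  case: j {GE G1 G2 q} => [|j].
    rewrite -addn1 natrD addrK (dvdp_ffactp_root _ bF) ?mul0r //.
    by lia.
  rewrite (_ : (shift_prod b j.+1).[i%:R] = 0) ?mulr0 //.
  apply: (dvdp_ffactp_root (n := n)); first by lia.
  by rewrite -add1n shift_prodD shift_prod1 dvdp_mulr.
by rewrite (q0 1%N) // (q0 0%N).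
Qed.

Lemma twisted_comp_bracket r s f g : twisted_comp r f -> twisted_comp s g ->
  twisted_comp (r + s) (pshift s f * g - f * pshift r g).
Proof.
move=> [f1 f2 _] [g1 g2 _].
have dvdB (x y z : {poly C}) : x %| y -> x %| z -> x %| y - z.
  by move=> xy xz; rewrite dvdp_add // dvdpNr.
split.
- by apply: dvdB; [exact: dvdp_mull | exact: dvdp_mulr].
- apply: dvdB.
    apply: dvdp_trans (shift_prod_dvd b r s) _.
    by apply: dvdp_mul => //; exact: dvdp_pshift.
  rewrite addrC mulrC; apply: dvdp_trans (shift_prod_dvd b s r) _.
  by apply: dvdp_mul => //; exact: dvdp_pshift.
case: r s f2 g2 => k [l|l] f2 g2 rs; try lia.
  rewrite NegzE (_ : l = k) in g2 *; last lia.
  exact: bracket_degree_m1.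
rewrite NegzE (_ : k = l) in f2 *; last lia.
have [q qE q12] := bracket_degree_m1 g1 f2.
exists (- q); last by rewrite !hornerN q12.
by rewrite mulNr -qE; ring.
Qed.

Lemma twisted_parabolic : W_parabolic n (dop_comps twisted_comp).
Proof.
apply: dop_comps_parabolic twisted_comp_subspace _ _ _ twisted_comp_bracket.
- by move=> j f [].
- move=> [] // j f _ bf; split=> //=.
  by rewrite /shift_prod big_ord0 dvd1p.
exists (- 1), b; split; rewrite ?monic_neq0 ?ffactp_monic //.
exact: twisted_comp_ffactp.
Qed.

End TwistedParabolic.

Theorem lemma3p5 (R : realType) :
  (forall (n : nat) (p : set (What R[i])),
     (1 <= n)%N -> W_parabolic n p ->
     ((n <= 2)%N ->
        forall k : nat, (1 <= k)%N -> is_ideal (Icoef n p k))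
     /\
     (forall k : nat, (1 <= k)%N ->
        Icoef n p k <> [set 0] -> finite_codim (Icoef n p k)))
  /\
  (forall n : nat, (2 < n)%N ->
     exists p : set (What R[i]),
       W_parabolic n p /\ ~ is_ideal (Icoef n p 1)).
Proof.
split=> [n p n0 Wp|n n_gt2].
  split=> [n_le2 k k0|k k0 Inz]; first exact: Icoef_ideal.
  exact: Icoef_finite_codim.
exists (dop_comps (twisted_comp n)).
by split; [exact: twisted_parabolic | exact: twisted_not_ideal].
Qed.
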